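(* Let $X$ be a finite cell complex of dimension $d$ and $0\le i\le d$, with $\operatorname{rk}\widetilde H_{i-1}(X)=0$ and $\operatorname{rk}\widetilde H_i(X)=1$. Then the $i$-th standard harmonic cycle $\lambda=\sum_{U\in\mathcal U_i} w(C_U)\,C_U$ is a nonzero element of the harmonic space $\mathscr H_i(X)=\ker(\partial_i^t\partial_i+\partial_{i+1}\partial_{i+1}^t)\subseteq C_i(X;\mathbb Q)$.
   Context: Notation: $X_j$ is the finite set of $j$-cells of $X$ (in a fixed order), $C_j=C_j(X)$ is the free abelian group on $X_j$ for $0\le j\le d$, $C_{-1}=\mathbb Z$, other $C_j=0$; $\partial_j:C_j\to C_{j-1}$ is the integer cellular boundary matrix, with $\partial_0(x)=1$ for each vertex $x$ (augmented complex). $Z_j=\ker\partial_j$, $B_j=\operatorname{im}\partial_{j+1}$ (over $\mathbb Z$), $\widetilde H_j=Z_j/B_j$. $\mathcal S_i$ is the set of subcomplexes $Y$ with $X^{i-1}\subseteq Y\subseteq X^i$ ($X^j$ the $j$-skeleton); $Y$ is determined by its set $I(Y)\subseteq X_i$ of $i$-cells. For a $\mathbb Z$-basis $Z$ of $Z_{i-1}(X)$, $[\partial_i]_Z$ is the matrix of the columns of $\partial_i$ in the basis $Z$. An $i$-cycletree is $U\in\mathcal S_i$ with $|I(U)|=\operatorname{rk}Z_{i-1}(X)+1$; $\mathcal U_i$ is the set of all $i$-cycletrees. The cycle part $C_U\in Z_i(X)$: let $A$ be the $n\times(n+1)$ submatrix of $[\partial_i]_Z$ with columns indexed by $I(U)$,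 $n=\operatorname{rk}Z_{i-1}(X)$; the $j$-th entry of $C_U$ along $I(U)$ is $(-1)^j\det([A]_j)$, where $[A]_j$ is $A$ with its $j$-th column deleted; all entries outside $I(U)$ are $0$. Winding number: let $\overline\partial_{i+1}$ be a matrix whose columns form a $\mathbb Z$-basis of $B_i(X)$ (so it has $\operatorname{rk}Z_i(X)-1$ columns). For a fixed $\mathbb Z$-basis $Z'$ of $Z_i(X)$, $w:Z_i(X)\to\mathbb Z$ is $w(z)=\det([z]_{Z'},[\overline\partial_{i+1}]_{Z'})$, where $[\cdot]_{Z'}$ denotes coordinates in $Z'$. It is well defined up to a global sign; the same choice is used throughout. *)

(* Defs.v *)
From mathcomp Require Import all_boot all_order all_algebra.
From mathcomp Require Import boolp classical_sets.

Set Implicit Arguments.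
Unset Strict Implicit.
Unset Printing Implicit Defensive.

Import GRing.Theory.

Local Open Scope ring_scope.
Local Open Scope classical_set_scope.

(* A finite cell complex of dimension d enters through its cells and its       *)
(* integer cellular boundary matrices: the j-cells are indexed, in their fixed *)
(* order, by 'I_(ncells j), and bdry j is the matrix of C_(j+1) -> C_j. The    *)
(* axioms on bdry say that the augmented sequence is a chain complex.          *)
Record cell_complex (d : nat) := CellComplex {
  ncells : nat -> nat;
  bdry : forall j, 'M[int]_(ncells j, ncells j.+1);
  ncells_vertex : (0 < ncells 0)%N;
  ncells_top : (0 < ncells d)%N;
  ncells_above : forall j, (d < j)%N -> ncells j = 0%N;
  bdry_aug : forall e : 'I_(ncells 1), \sum_(v < ncells 0) bdry 0 v e = 0;
  bdry_bdry : forall j, bdry j *m bdry j.+1 = 0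
}.

Section Chains.
Variables (d : nat) (X : cell_complex d).

(* Degrees start at -1, so the groups C, Z and B are indexed with a shift by   *)
(* one (rkC k is the rank of C_(k-1)); the boundary maps are not shifted.      *)
Definition rkC (k : nat) : nat := if k is j.+1 then ncells X j else 1%N.

(* The boundary map d_k : C_k -> C_(k-1); for k = 0, the augmentation. *)
Definition bd (k : nat) : 'M[int]_(rkC k, rkC k.+1) :=
  match k with
  | 0 => const_mx 1
  | j.+1 => bdry X j
  end.

(* Z_(k-1); since C_(-2) = 0, all of C_(-1) consists of cycles. *)
Definition cycles (k : nat) : set 'cV[int]_(rkC k) :=
  match k with
  | 0 => setT
  | j.+1 => [set z | bd j *m z = 0]
  end.

(* B_(k-1) *)
Definition boundaries (k : nat) : set 'cV[int]_(rkC k) :=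
  range (fun c : 'cV[int]_(rkC k.+1) => bd k *m c).

Definition laplacian (i : nat) : 'M[rat]_(rkC i.+1) :=
  let D := map_mx intr (bd i) in
  let D' := map_mx intr (bd i.+1) in
  D^T *m D + D' *m D'^T.

Definition harmonic (i : nat) : set 'cV[rat]_(rkC i.+1) :=
  [set h | laplacian i *m h = 0].

End Chains.

Arguments cycles {d} X k.
Arguments boundaries {d} X k.
Arguments harmonic {d} X i.

Section Lattices.
Variable m : nat.
Implicit Types L M : set 'cV[int]_m.

(* The classes of the columns of V in L / M are linearly independent over Z. *)
Definition independent_mod L M r (V : 'M[int]_(m, r)) : Prop :=
  (forall j, L (col j V)) /\ (forall c : 'cV[int]_r, M (V *m c) -> c = 0).

(* The abelian group L / M has rank r, the maximal number of elements that     *)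
(* are linearly independent over Z.                                            *)
Definition rk_quotient L M (r : nat) : Prop :=
  (exists V : 'M[int]_(m, r), independent_mod L M V) /\
  (forall s (V : 'M[int]_(m, s)), independent_mod L M V -> (s <= r)%N).

(* The columns of E form a Z-basis of L; in particular L has rank r. *)
Definition is_Zbasis L r (E : 'M[int]_(m, r)) : Prop :=
  range (fun c : 'cV[int]_r => E *m c) = L /\
  injective (fun c : 'cV[int]_r => E *m c).

(* The matrix [M]_E of the columns of M in the basis E; the default value 0 is *)
(* irrelevant as soon as these columns lie in the group with basis E.          *)
Definition coords r (E : 'M[int]_(m, r)) p (M : 'M[int]_(m, p)) :
    'M[int]_(r, p) :=
  xget 0 [set C | M = E *m C].

End Lattices.

(* rk_reduced_homology X k r: the group Z_(k-1) / B_(k-1) has rank r. *)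
Definition rk_reduced_homology d (X : cell_complex d) (k : nat) : nat -> Prop :=
  rk_quotient (cycles X k) (boundaries X k).

(* A complex between the (i-1)- and the i-skeleton is given by its set of      *)
(* i-cells, here m = #|X_i|; in a cycletree, n is the rank of Z_(i-1).         *)
Definition cycletree (m n : nat) := {U : {set 'I_m} | #|U| == n.+1}.

Section CyclePart.
Variables (m n : nat) (D : 'M[int]_(n, m)) (U : cycletree m n).

(* The j-th cell of U, in increasing order. *)
Definition cell_of (j : 'I_n.+1) : 'I_m :=
  enum_val (cast_ord (esym (eqP (valP U))) j).

(* For D = [d_i]_Z this is C_U. The j-th entry has ordinal index j - 1, whence *)
(* the exponent.                                                               *)
Definition cycle_part : 'cV[int]_m :=
  let A : 'M[int]_(n, n.+1) := colsub cell_of D in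
  \sum_(j < n.+1) ((-1) ^+ j.+1 * \det (col' j A)) *: delta_mx (cell_of j) 0.

End CyclePart.

(* E is a Z-basis of Z_i and dbar one of B_i; rk Z_i = 1 + rk B_i makes the    *)
(* matrix square.                                                              *)
Definition winding m r (E : 'M[int]_(m, 1 + r)) (dbar : 'M[int]_(m, r))
    (z : 'cV[int]_m) : int :=
  \det (row_mx (coords E z) (coords E dbar)).

Definition standard_harmonic_cycle d (X : cell_complex d) (i n r : nat)
    (Z : 'M[int]_(rkC X i, n)) (Z' : 'M[int]_(rkC X i.+1, 1 + r))
    (dbar : 'M[int]_(rkC X i.+1, r)) : 'cV[int]_(rkC X i.+1) :=
  \sum_(U : cycletree (rkC X i.+1) n)
    let C := cycle_part (coords Z (bd X i)) U in
    winding Z' dbar C *: C.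

(* Main.v *)
Require Import Defs.
From mathcomp Require Import all_boot all_order all_algebra.
From mathcomp Require Import fingroup perm.
From mathcomp Require Import boolp classical_sets.

Import GRing.Theory Num.Theory.

Local Open Scope ring_scope.
Local Open Scope classical_set_scope.

(** For every i-cycle z, the chain lambda satisfies
      <lambda, z> = det(D D^T) * w(z),
    where D = [d_i]_Z and < , > is the standard inner product of C_i. In other
    words, lambda represents, up to a nonzero factor, the linear form w with
    respect to this inner product; everything follows from that.

    The identity comes from the resolution
      sum over U of <C_U, z> C_U = det(D D^T) z      for D z = 0,
    to which the linear form w is applied. To see the resolution, read C_U by
    Laplace expansion: <C_U, x> is, up to a sign that does not depend on U, the
    maximal minor, on the columns U, of D bordered above by the row x^T. So the
    k-th entry of the left-hand side is a sum over U of products of two maximal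
    minors, namely of D bordered by z^T and of D bordered by the k-th unit
    vector, and by Cauchy-Binet it is one determinant of size n + 1. As D z = 0,
    that determinant is block triangular with diagonal blocks z_k and D D^T.

    Now w vanishes on boundaries, so lambda is orthogonal to B_i; each C_U is a
    cycle by Cramer's rule, so lambda is one too. Hence both d_i and the
    transpose of d_(i+1) kill lambda, and lambda is harmonic.

    Finally lambda is nonzero because both factors are: D D^T is nonsingular
    since H_(i-1) has rank 0, which gives D full row rank over the rationals
    ([det_gram_neq0]), and w is not identically zero since B_i has corank one
    in Z_i ([det_row_mx_neq0]). *)

(** * The Cauchy-Binet formula *)

Lemma cell_of_inj {m n} (U : cycletree m n) : injective (cell_of U).
Proof. by move=> j k /enum_val_inj/cast_ord_inj. Qed.

Lemma mem_cell_of {m n} (U : cycletree m n) j : cell_of U j \in val U.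
Proof. exact: enum_valP. Qed.

Lemma cell_of_onto {m n} (U : cycletree m n) x :
  x \in val U -> exists j, cell_of U j = x.
Proof.
move=> Ux; exists (cast_ord (eqP (valP U)) (enum_rank_in Ux x)).
by rewrite /cell_of cast_ordK enum_rankK_in.
Qed.

Lemma imset_cell_of_perm {m n} (U : cycletree m n) (s : 'S_n.+1) :
  [set cell_of U (s j) | j : 'I_n.+1]%SET = val U.
Proof.
apply/setP=> x; apply/imsetP/idP => [[j _ ->]|/cell_of_onto[j <-]].
  exact: mem_cell_of.
by exists ((s^-1)%g j); rewrite ?permKV.
Qed.

(** The injections of 'I_n.+1 into 'I_m, factored as a permutation followed by
    the increasing enumeration of their image; the pair is unique, by
    [permuted_cells_inj] and [imset_permuted_cells]. *)
Definition permuted_cells {m n} (Us : cycletree m n * 'S_n.+1) :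
    {ffun 'I_n.+1 -> 'I_m} :=
  [ffun j => cell_of Us.1 (Us.2 j)].

Lemma permuted_cells_inj {m n} : injective (@permuted_cells m n).
Proof.
move=> [U s] [V t] /ffunP eqUV.
have {}eqUV j : cell_of U (s j) = cell_of V (t j).
  by have := eqUV j; rewrite !ffunE.
have defV : U = V.
  apply: val_inj; rewrite -(imset_cell_of_perm U s) -(imset_cell_of_perm V t).
  by apply: eq_imset.
rewrite -defV in eqUV *; congr (_, _); apply/permP=> j.
exact/(cell_of_inj U)/eqUV.
Qed.

Lemma imset_permuted_cells m n :
  [set permuted_cells Us | Us : cycletree m n * 'S_n.+1]%SET
    = [set f : {ffun 'I_n.+1 -> 'I_m} | injectiveb f]%SET.
Proof.
apply/setP=> f; rewrite inE; apply/imsetP/injectiveP => [[[U s] _ ->]|f_inj].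
  by move=> j k; rewrite !ffunE => /cell_of_inj/perm_inj.
have Uf : #|[set f j | j : 'I_n.+1]%SET| == n.+1.
  by rewrite card_imset // card_ord.
pose U : cycletree m n := Sub [set f j | j : 'I_n.+1]%SET Uf.
have Uf_mem j : f j \in val U by apply: imset_f.
have [s sP] := fin_all_exists (fun j => cell_of_onto U _ (Uf_mem j)).
have s_inj : injective s by move=> j k eq_s; apply: f_inj; rewrite -!sP eq_s.
exists (U, perm s_inj) => //.
by apply/ffunP=> j; rewrite ffunE /= permE sP.
Qed.

Lemma det_rowsub_ffun (R : comPzRingType) m n (N : 'M[R]_(m, n))
    (f : {ffun 'I_n -> 'I_m}) : ~~ injectiveb f -> \det (rowsub f N) = 0.
Proof.
case/injectivePn=> j [k neq_jk eq_f].
by apply: (determinant_alternate neq_jk) => l; rewrite !mxE eq_f.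
Qed.

(** Expanding each entry of the product turns the determinant into a sum over
    all maps f from rows of M to columns of M. Maps that are not injective give
    a minor of N with two equal rows; the others are grouped by their image U,
    where the sum over the orderings of U rebuilds the minor of M. *)
Lemma cauchy_binet (R : comPzRingType) m n
    (M : 'M[R]_(n.+1, m)) (N : 'M[R]_(m, n.+1)) :
  \det (M *m N) = \sum_(U : cycletree m n)
    \det (colsub (cell_of U) M) * \det (rowsub (cell_of U) N).
Proof.
pose F (f : {ffun 'I_n.+1 -> 'I_m}) :=
  (\prod_i M i (f i)) * \det (rowsub f N).
transitivity (\sum_f F f).
  rewrite /determinant.
  under eq_bigr => s _.
    under eq_bigr => i _ do rewrite mxE.
    rewrite bigA_distr_bigA big_distrr /=.
    over.
  rewrite exchange_big; apply: eq_bigr => f _; rewrite /F big_distrr /=.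
  apply: eq_bigr => s _; rewrite big_split /= mulrCA; congr (_ * (_ * _)).
  by apply: eq_bigr => i _; rewrite mxE.
rewrite (bigID (fun f : {ffun _} => injectiveb f)) /= addrC.
rewrite big1 ?add0r; last first.
  by move=> f /det_rowsub_ffun f0; rewrite /F f0 mulr0.
transitivity (\sum_(f in [set permuted_cells Us
    | Us : cycletree m n * 'S_n.+1]%SET) F f).
  by apply: eq_bigl => f; rewrite imset_permuted_cells inE.
rewrite big_imset /=; last by move=> ? ? _ _; apply: permuted_cells_inj.
transitivity (\sum_U \sum_s F (permuted_cells (U, s))).
  by rewrite pair_bigA; apply: eq_big => [[U s]|[U s] _]; rewrite ?inE.
apply: eq_bigr => U _; rewrite /determinant big_distrl; apply: eq_bigr => s _ /=.
have -> : F (permuted_cells (U, s)) =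
    (\prod_i M i (cell_of U (s i))) * \det (row_perm s (rowsub (cell_of U) N)).
  rewrite /F; congr (_ * _).
    by apply: eq_bigr => i _; rewrite ffunE.
  by congr determinant; apply/matrixP=> j k; rewrite !mxE ffunE.
rewrite row_permE det_mulmx det_perm mulrA; congr (_ * _); rewrite mulrC.
by congr (_ * _); apply: eq_bigr => i _; rewrite mxE.
Qed.

(** * Cycle parts as bordered minors *)

Section CyclePartTheory.
Context {m n : nat} (D : 'M[int]_(n, m)).

(** Laplace expansion along the bordering row. The sign comes from the entries
    of C_U starting with -1 whereas an expansion along row 0 starts with +1. *)
Lemma dot_cycle_part (x : 'rV[int]_m) (U : cycletree m n) :
  (x *m cycle_part D U) 0 0
    = - \det (colsub (cell_of U) (col_mx x D) : 'M_(1 + n)).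
Proof.
rewrite (expand_det_row _ 0) mulmx_sumr summxE -sumrN.
apply: eq_bigr => j _; rewrite -scalemxAr -colE [LHS]mxE [in LHS]mxE.
have -> : 0 = lshift n (0 : 'I_1) by apply/val_inj.
rewrite [X in - (X * _)]mxE [X in - (X * _)]col_mxEu /cofactor exprS !mulNr mul1r.
congr (- _); rewrite mulrC; congr (_ * (_ * _)); congr determinant.
apply/matrixP=> a b; rewrite 2!mxE [RHS]mxE [RHS]mxE [RHS]mxE.
have -> : lift (lshift n (0 : 'I_1)) a = rshift 1 a by apply/val_inj.
by rewrite col_mxEd.
Qed.

(** Cramer's rule: bordering D by one of its own rows repeats that row. *)
Lemma mulmx_cycle_part U : D *m cycle_part D U = 0.
Proof.
apply/colP=> i; rewrite mxE; transitivity ((row i D *m cycle_part D U) 0 0).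
  by rewrite mxE; apply: eq_bigr => k _; rewrite mxE.
rewrite dot_cycle_part.
have neq : lshift n (0 : 'I_1) != rshift 1 i by [].
rewrite (determinant_alternate neq) ?oppr0 ?[RHS]mxE // => j.
by rewrite [LHS]mxE [RHS]mxE col_mxEu col_mxEd mxE.
Qed.

(** The cycle parts resolve a multiple of the identity on the kernel of D: entry
    k is the Cauchy-Binet sum for D bordered by z^T and D bordered by the k-th
    unit vector, whose product is block triangular because D z = 0. *)
Lemma sum_dot_cycle_part (z : 'cV[int]_m) : D *m z = 0 ->
  \sum_(U : cycletree m n) (z^T *m cycle_part D U) 0 0 *: cycle_part D U
    = \det (D *m D^T) *: z.
Proof.
move=> Dz; apply/colP=> k; rewrite summxE mxE.
pose e : 'rV[int]_m := delta_mx 0 k.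
transitivity (\det (col_mx z^T D *m (col_mx e D)^T)); last first.
  rewrite tr_col_mx mul_col_row -[z^T *m D^T]trmx_mul Dz trmx0 det_lblock.
  by rewrite trmx_delta -colE det_mx11 !mxE mulrC.
rewrite (@cauchy_binet _ m n); apply: eq_bigr => U _.
have -> : rowsub (cell_of U) (col_mx e D)^T = (colsub (cell_of U) (col_mx e D))^T.
  by apply/matrixP=> a b; rewrite !mxE.
rewrite det_tr; have := dot_cycle_part z^T U; have := dot_cycle_part e U.
rewrite -rowE !mxE => -> ->.
by rewrite mulrNN.
Qed.

End CyclePartTheory.

(** * Coordinates and the winding number *)

Lemma coordsE {m r} {E : 'M[int]_(m, r)} p (C : 'M[int]_(r, p)) :
  injective (fun c : 'cV[int]_r => E *m c) -> coords E (E *m C) = C.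
Proof.
move=> E_inj.
apply: xget_unique => // B /= eqEB; apply/matrixP=> i j.
suff /colP/(_ i) : col j B = col j C by rewrite !mxE.
by apply: E_inj => /=; rewrite !colE !mulmxA eqEB.
Qed.

Lemma Zbasis_span {m r p} {L : set 'cV[int]_m} {E : 'M[int]_(m, r)}
    {V : 'M[int]_(m, p)} :
  is_Zbasis L E -> (forall j, L (col j V)) -> exists C, V = E *m C.
Proof.
move=> [<- _] LV.
have EV j : exists c, E *m c = col j V by have [c _ <-] := LV j; exists c.
have [c cP] := fin_all_exists EV.
exists (\matrix_(i, j) c j i 0); apply/matrixP=> i j.
have /colP/(_ i) := cP j; rewrite !mxE => <-.
by apply: eq_bigr => k _; rewrite mxE.
Qed.

Section Winding.
Context {m r : nat} {E : 'M[int]_(m, 1 + r)} (P : 'M[int]_(1 + r, r)).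

Lemma windingE c : injective (fun c : 'cV[int]_(1 + r) => E *m c) ->
  winding E (E *m P) (E *m c) = \det (row_mx c P).
Proof. by move=> E_inj; rewrite /winding !coordsE. Qed.

(** Expanding along the first column writes the winding number as a linear form
    in the coordinates, whose coefficients are the cofactors of that column. *)
Lemma winding_linear : injective (fun c : 'cV[int]_(1 + r) => E *m c) ->
  exists g : 'rV[int]_(1 + r),
  forall c, winding E (E *m P) (E *m c) = (g *m c) 0 0.
Proof.
move=> E_inj.
(* Cofactors along column 0 ignore its entries, so 0 is a mere filler. *)
pose g : 'rV[int]_(1 + r) := \row_i cofactor (row_mx 0 P) i 0.
exists g => c; rewrite windingE // (expand_det_col _ 0) [RHS]mxE.
apply: eq_bigr => i _; rewrite [in RHS]mxE mulrC.
have -> : 0 = lshift r (0 : 'I_1) by apply/val_inj.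
rewrite [X in _ * X = _]row_mxEl; congr (_ * _); congr (_ * _); congr determinant.
apply/matrixP=> a b; rewrite 2!mxE [RHS]mxE [RHS]mxE.
have -> : lift (lshift r (0 : 'I_1)) b = rshift 1 b by apply/val_inj.
exact: etrans (row_mxEr _ _ _ _) (esym (row_mxEr _ _ _ _)).
Qed.

Lemma winding_boundary a : injective (fun c : 'cV[int]_(1 + r) => E *m c) ->
  winding E (E *m P) (E *m (P *m a)) = 0.
Proof.
move=> E_inj; rewrite windingE // -det_tr; apply/eqP/det0P.
exists (row_mx (-1) a^T).
  by rewrite row_mx_eq0 oppr_eq0 oner_eq0.
by rewrite tr_row_mx mul_row_col mulNmx mul1mx trmx_mul addNr.
Qed.

End Winding.

Lemma dot_self_eq0 {m} {x : 'cV[int]_m} : x^T *m x = 0 -> x = 0.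
Proof.
move/matrixP/(_ 0 0); rewrite !mxE => /eqP.
rewrite psumr_eq0 => [/allP x0|k _]; last by rewrite mxE sqr_ge0.
apply/colP=> k; have := x0 k (mem_index_enum k).
by rewrite /= !mxE mulf_eq0 orbb => /eqP.
Qed.

(** Take for y a nonzero vector orthogonal to the columns of P, which exists for
    lack of columns: it is independent of them because its inner product with
    itself is nonzero. *)
Lemma det_row_mx_neq0 {r} (P : 'M[int]_(1 + r, r)) :
  (forall a : 'cV[int]_r, P *m a = 0 -> a = 0) ->
  exists y : 'cV[int]_(1 + r), \det (row_mx y P) != 0.
Proof.
move=> P_inj.
(* Padding P by a zero column gives a singular matrix; v kills it on the left. *)
have /eqP/det0P[v vN0 vP0] : \det (row_mx (0 : 'cV[int]_(1 + r)) P) = 0.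
  rewrite -det_tr; apply/eqP/det0P; exists (row_mx 1 0).
    by rewrite row_mx_eq0 oner_eq0.
  by rewrite tr_row_mx mul_row_col trmx0 mulmx0 mul0mx addr0.
have {}vP0 : v *m P = 0.
  by move: vP0; rewrite mul_mx_row -row_mx0 => /eq_row_mx[].
exists v^T; apply: contra vN0; rewrite -det_tr => /det0P[u uN0].
rewrite -[u]hsubmxK tr_row_mx mul_row_col trmxK => u0.
have u1 : lsubmx u *m (v *m v^T) = 0.
  have := congr1 (mulmx^~ v^T) u0.
  by rewrite mul0mx mulmxDl -!mulmxA -trmx_mul vP0 trmx0 mulmx0 addr0.
have [vv0|vvN0] := eqVneq ((v *m v^T) 0 0) 0.
  rewrite -[v]trmxK (@dot_self_eq0 _ v^T) ?trmx0 // trmxK.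
  by apply/matrixP=> i j; rewrite !ord1 vv0 mxE.
have ul0 : lsubmx u = 0.
  apply/matrixP=> i j; rewrite !ord1 [RHS]mxE; move/matrixP/(_ 0 0): u1.
  rewrite [LHS]mxE big_ord1 [RHS]mxE => /eqP.
  by rewrite mulf_eq0 (negPf vvN0) orbF => /eqP.
case/eqP: uN0; rewrite -[u]hsubmxK ul0.
move: u0; rewrite ul0 mul0mx add0r => /(congr1 trmx).
rewrite trmx_mul trmxK trmx0 => /P_inj/(congr1 trmx).
by rewrite trmxK trmx0 => ->; rewrite row_mx0.
Qed.

(** * Chains, cycles and boundaries *)

Lemma bd_bd d (X : cell_complex d) k : bd X k *m bd X k.+1 = 0.
Proof.
case: k => [|k] /=; last exact: bdry_bdry.
apply/matrixP=> i e; rewrite !mxE -[RHS](bdry_aug e).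
by apply: eq_bigr => v _; rewrite mxE mul1r.
Qed.

Lemma boundaries_sub_cycles d (X : cell_complex d) k :
  boundaries X k `<=` cycles X k.
Proof.
by case: k => [//|k] _ [c _ <-] /=; rewrite mulmxA bd_bd mul0mx.
Qed.

Lemma boundaries_col d (X : cell_complex d) k j :
  boundaries X k (col j (bd X k)).
Proof. by exists (delta_mx j 0) => //=; rewrite -colE. Qed.

Lemma cycles_multiple d (X : cell_complex d) k (z : 'cV[int]_(rkC X k)) :
  rk_reduced_homology X k 0 -> cycles X k z ->
  exists2 a : int, a != 0 & boundaries X k (a *: z).
Proof.
move=> [_ rk0] Zz; apply: contrapT => noa.
suff /rk0 : independent_mod (cycles X k) (boundaries X k) (z : 'M_(_, 1)) by [].
split=> [j|c]; first by rewrite ord1 col_id.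
rewrite [c]mx11_scalar mul_mx_scalar => Bcz.
by have [->|cN0] := eqVneq (c 0 0) 0; [rewrite raddf0 | case: noa; exists (c 0 0)].
Qed.

(** A row v killed by D D^T has |v D|^2 = 0, so v D = 0. Homology of rank 0
    is torsion, so some nonzero multiple of each basis cycle is a boundary, i.e.
    the image of D contains nonzero multiples of all unit vectors; hence
    v = 0. *)
Lemma det_gram_neq0 d (X : cell_complex d) k n (Z : 'M[int]_(rkC X k, n))
    (D : 'M[int]_(n, rkC X k.+1)) :
  rk_reduced_homology X k 0 -> is_Zbasis (cycles X k) Z -> bd X k = Z *m D ->
  \det (D *m D^T) != 0.
Proof.
move=> rk0 [ranZ Z_inj] defD; apply/det0P=> -[v vN0].
move/(congr1 (mulmx^~ v^T)); rewrite mul0mx -mulmxA -mulmxA -trmx_mul.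
rewrite mulmxA -{1}[v *m D]trmxK => /dot_self_eq0/(congr1 trmx).
rewrite trmxK trmx0 => vD0; case/eqP: vN0; apply/rowP=> j; rewrite [RHS]mxE.
have ZZ : cycles X k (Z *m delta_mx j 0) by rewrite -ranZ; exists (delta_mx j 0).
have [a aN0 [x _]] := cycles_multiple _ _ _ _ rk0 ZZ.
rewrite defD -mulmxA scalemxAr => /Z_inj/(congr1 (mulmx v)).
rewrite mulmxA vD0 mul0mx -scalemxAr -colE => /esym/matrixP/(_ 0 0).
by rewrite !mxE => /eqP; rewrite mulf_eq0 (negPf aN0) => /eqP.
Qed.

Lemma harmonic_intr d (X : cell_complex d) i (c : 'cV[int]_(rkC X i.+1)) :
  bd X i *m c = 0 -> (bd X i.+1)^T *m c = 0 -> harmonic X i (map_mx intr c).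
Proof.
move=> dc dtc.
suff: laplacian X i *m map_mx intr c = 0 by [].
rewrite /laplacian mulmxDl -!mulmxA !map_trmx -!map_mxM dc dtc.
by rewrite !mulmx0 !map_mx0 addr0.
Qed.

(** * The standard harmonic cycle *)

Theorem corollary5p0p1 (d : nat) (X : cell_complex d) (i : nat)
    (hi : (i <= d)%N)
    (rkH_pred : rk_reduced_homology X i 0)
    (rkH : rk_reduced_homology X i.+1 1)
    (n r : nat)
    (Z : 'M[int]_(rkC X i, n)) (hZ : is_Zbasis (cycles X i) Z)
    (Z' : 'M[int]_(rkC X i.+1, 1 + r))
    (hZ' : is_Zbasis (cycles X i.+1) Z')
    (dbar : 'M[int]_(rkC X i.+1, r))
    (hdbar : is_Zbasis (boundaries X i.+1) dbar) :
  let lambda : 'cV[rat]_(rkC X i.+1) :=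
    map_mx intr (standard_harmonic_cycle Z Z' dbar) in
  harmonic X i lambda /\ lambda <> 0.
Proof.
have [D defD] : exists D, bd X i = Z *m D.
  by apply: (Zbasis_span hZ) => j; apply/boundaries_sub_cycles/boundaries_col.
have Z_inj := hZ.2; have Z'_inj := hZ'.2.
have defDc : coords Z (bd X i) = D by rewrite defD coordsE.
have [P defP] : exists P, dbar = Z' *m P.
  apply: (Zbasis_span hZ') => j; apply: boundaries_sub_cycles.
  by rewrite -hdbar.1; exists (delta_mx j 0) => //=; rewrite -colE.
have DZ' : D *m Z' = 0.
  apply/matrixP=> a j; rewrite [RHS]mxE.
  have ZZ'j : cycles X i.+1 (Z' *m delta_mx j 0).
    by rewrite -hZ'.1; exists (delta_mx j 0).
  suff /colP/(_ a) : col j (D *m Z') = 0 by rewrite !mxE.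
  by apply: Z_inj; rewrite /= mulmx0 colE -mulmxA mulmxA -defD.
set C := cycle_part D; set w := winding Z' dbar.
set delta := \det (D *m D^T).
have deltaN0 : delta != 0 by apply: det_gram_neq0 hZ defD.
rewrite /= /standard_harmonic_cycle defDc.
set lam := (X in map_mx _ X).
have defC U : exists c, C U = Z' *m c.
  apply: (Zbasis_span hZ') => j; rewrite ord1 col_id /=.
  by rewrite defD -mulmxA mulmx_cycle_part mulmx0.
have [c cP] := fin_all_exists defC.
have [g gP] := winding_linear (E := Z') P Z'_inj.
(* lambda represents w: the resolution of delta * z, in coordinates, under w. *)
have dot_lam y : (Z' *m y)^T *m lam = (delta * w (Z' *m y))%:M.
  have sumc : \sum_U ((Z' *m y)^T *m C U) 0 0 *: c U = delta *: y.
    apply: Z'_inj => /=; rewrite -scalemxAr -sum_dot_cycle_part; last first.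
      by rewrite mulmxA DZ' mul0mx.
    by rewrite mulmx_sumr; apply: eq_bigr => U _; rewrite -scalemxAr -cP.
  rewrite [LHS]mx11_scalar; congr (_%:M).
  transitivity ((g *m (delta *: y)) 0 0); last first.
    by rewrite -scalemxAr [LHS]mxE /w defP gP.
  rewrite -sumc !mulmx_sumr !summxE; apply: eq_bigr => U _.
  rewrite -!scalemxAr [LHS]mxE [RHS]mxE mulrC; congr (_ * _).
  by rewrite -/C cP defP gP.
have dlam : bd X i *m lam = 0.
  rewrite defD -mulmxA mulmx_sumr big1 ?mulmx0 // => U _.
  by rewrite -scalemxAr mulmx_cycle_part scaler0.
have [A defA] : exists A, bd X i.+1 = dbar *m A.
  by apply: (Zbasis_span hdbar) => j; apply: boundaries_col.
have dtlam : (bd X i.+1)^T *m lam = 0.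
  apply/row_matrixP=> j; rewrite row_mul -tr_col defA defP.
  rewrite colE -!mulmxA dot_lam /w defP winding_boundary //.
  by rewrite mulr0 raddf0 row0.
split; first exact: harmonic_intr.
have [y yP] : exists y : 'cV[int]_(1 + r), \det (row_mx y P) != 0.
  apply: det_row_mx_neq0 => a Pa0; apply: hdbar.2 => /=.
  by rewrite defP -mulmxA Pa0 !mulmx0.
move=> lam0; have {}lam0 : lam = 0.
  apply/matrixP=> a b; move/matrixP/(_ a b): lam0; rewrite !mxE => /eqP.
  by rewrite intr_eq0 => /eqP.
move: (dot_lam y); rewrite lam0 mulmx0 /w defP windingE //.
move/matrixP/(_ 0 0)/esym/eqP; rewrite !mxE mulr1n mulf_eq0.
by rewrite (negPf deltaN0) (negPf yP).
Qed.
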